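(* Let $H_1,H_2$ be complex Hilbert spaces and let $T$ be a densely defined closed operator from $H_1$ to $H_2$ which is bounded below (i.e. there is $c>0$ with $\|Tx\|\geq c\|x\|$ for all $x\in D(T)$). Then for every $\epsilon>0$ there exists a densely defined closed minimum attaining operator $\tilde T$ from $H_1$ to $H_2$ such that $\theta(T,\tilde T)\leq\epsilon$.
   Context: Hilbert spaces are complex and infinite dimensional. For a densely defined closed operator $A$ with domain $D(A)$, $m(A)=\inf\{\|Ax\|: x\in D(A),\ \|x\|=1\}$, and $A$ is minimum attaining if there exists $x_0\in D(A)$, $\|x_0\|=1$, with $\|Ax_0\|=m(A)$. The gap between densely defined closed operators is $\theta(A,B)=\|P_{G(A)}-P_{G(B)}\|$, where $G(A)=\{(Ax,x):x\in D(A)\}$ and $P_M$ is the orthogonal projection onto $M$. *)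

(* Defs.v *)
From mathcomp Require Import all_boot all_order all_algebra.
From mathcomp Require Import all_classical all_reals.
From mathcomp.real_closed Require Export complex.
Set Implicit Arguments. Unset Strict Implicit. Unset Printing Implicit Defensive.
Import Order.TTheory GRing.Theory Num.Theory.
Local Open Scope ring_scope.
Local Open Scope classical_set_scope.

Section Hilbert.
Variable R : realType.
Local Notation C := R[i].

(** Complex inner product: linear in the first argument, hermitian,
    positive definite.  (0 <= z in C means z is real and nonnegative.) *)
Definition inner_product (V : lmodType C) (ip : V -> V -> C) : Prop :=
  [/\ forall (a : C) (x y z : V), ip (a *: x + y) z = a * ip x z + ip y z,
      forall x y, ip y x = (ip x y)^*,
      forall x, 0 <= ip x x
    & forall x, ip x x = 0 -> x = 0].

Definition hnorm (V : lmodType C) (ip : V -> V -> C) (x : V) : R :=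
  Num.sqrt (complex.Re (ip x x)).

Definition hconv (V : lmodType C) (ip : V -> V -> C) (u : nat -> V) (l : V) :=
  forall e : R, 0 < e -> exists N : nat, forall n, (N <= n)%N ->
    hnorm ip (u n - l) < e.

Definition hcauchy (V : lmodType C) (ip : V -> V -> C) (u : nat -> V) :=
  forall e : R, 0 < e -> exists N : nat, forall m n, (N <= m)%N -> (N <= n)%N ->
    hnorm ip (u m - u n) < e.

Definition hcomplete (V : lmodType C) (ip : V -> V -> C) :=
  forall u : nat -> V, hcauchy ip u -> exists l, hconv ip u l.

Definition infinite_dim (V : lmodType C) :=
  forall n : nat, exists v : 'I_n -> V,
    forall c : 'I_n -> C, \sum_(i < n) c i *: v i = 0 -> forall i, c i = 0.

Definition hilbert (V : lmodType C) (ip : V -> V -> C) : Prop :=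
  [/\ inner_product ip, hcomplete ip & infinite_dim V].

Section Operators.
Variables (H1 H2 : lmodType C) (ip1 : H1 -> H1 -> C) (ip2 : H2 -> H2 -> C).

(** An (unbounded) operator from H1 to H2 is a pair (D, T): its domain
    D : set H1 and a function T : H1 -> H2 whose values matter only on D. *)
Definition lin_subspace (V : lmodType C) (D : set V) :=
  D 0 /\ forall (a : C) x y, D x -> D y -> D (a *: x + y).

Definition dense_in (V : lmodType C) (ip : V -> V -> C) (D : set V) :=
  forall (x : V) (e : R), 0 < e -> exists y, D y /\ hnorm ip (x - y) < e.

Definition linear_on (D : set H1) (T : H1 -> H2) :=
  forall (a : C) x y, D x -> D y -> T (a *: x + y) = a *: T x + T y.

Definition closed_op (D : set H1) (T : H1 -> H2) :=
  forall (u : nat -> H1) (x : H1) (y : H2),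
    (forall n, D (u n)) -> hconv ip1 u x -> hconv ip2 (T \o u) y ->
    D x /\ T x = y.

Definition densely_defined_closed (D : set H1) (T : H1 -> H2) :=
  [/\ lin_subspace D, dense_in ip1 D, linear_on D T & closed_op D T].

Definition bounded_below (D : set H1) (T : H1 -> H2) :=
  exists c : R, 0 < c /\ forall x, D x -> c * hnorm ip1 x <= hnorm ip2 (T x).

Definition min_modulus (D : set H1) (T : H1 -> H2) : R :=
  inf [set hnorm ip2 (T x) | x in [set x | D x /\ hnorm ip1 x = 1]].

Definition min_attaining (D : set H1) (T : H1 -> H2) :=
  exists x0, [/\ D x0, hnorm ip1 x0 = 1 & hnorm ip2 (T x0) = min_modulus D T].

Definition graph (D : set H1) (T : H1 -> H2) : set (H2 * H1) :=
  [set z | exists x, D x /\ z = (T x, x)].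

Definition pip (z w : H2 * H1) : C := ip2 z.1 w.1 + ip1 z.2 w.2.
Definition psub (z w : H2 * H1) : H2 * H1 := (z.1 - w.1, z.2 - w.2).
Definition pnorm (z : H2 * H1) : R := Num.sqrt (complex.Re (pip z z)).

Definition orth_proj (M : set (H2 * H1)) (z : H2 * H1) : H2 * H1 :=
  xget (0, 0) [set p | M p /\ forall m, M m -> pip (psub z p) m = 0].

Definition opnorm (f : H2 * H1 -> H2 * H1) : R :=
  sup [set pnorm (f z) | z in [set z | pnorm z <= 1]].

Definition gap (DA : set H1) (A : H1 -> H2) (DB : set H1) (B : H1 -> H2) : R :=
  opnorm (fun z => psub (orth_proj (graph DA A) z) (orth_proj (graph DB B) z)).

End Operators.
End Hilbert.

(* Main.v *)
(** Let m = m(T) > 0 and let x0 in D(T) be a unit vector with ||T x0|| < m / (1 - eta).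
    The rank-one perturbation T' x = T x - eta <x, x0> T x0 has
    m' = m(T') <= (1 - eta) ||T x0|| < m. The form Q x = ||T' x||^2 - m'^2 ||x||^2 is
    nonnegative on D(T), and on the hyperplane <x, x0> = 0, where T' = T, it is at least
    (m^2 - m'^2) ||x||^2. A minimizing sequence for m', rescaled to <z, x0> = 1, satisfies
    Q z -> 0, so the parallelogram law for Q makes it Cauchy, and by closedness its limit is
    a nonzero zero of Q: T' attains its minimum modulus. If p and q are the projections of z
    onto the two graphs and ||T - T'|| <= s, then ||p - q||^2 <= 2 s ||z||^2. *)
Require Import Defs.
From mathcomp Require Import all_boot all_order all_algebra.
From mathcomp Require Import all_classical all_reals.
From mathcomp.real_closed Require Import complex.
From mathcomp Require Import ring lra.
Set Implicit Arguments.
Unset Strict Implicit.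
Unset Printing Implicit Defensive.
Import Order.TTheory GRing.Theory Num.Theory.
Local Open Scope ring_scope.
Local Open Scope classical_set_scope.

Local Notation Re := complex.Re.
Local Notation Im := complex.Im.
Local Notation normc := ComplexField.Normc.normc.

(** * Real and imaginary parts and the modulus of complex numbers *)

Section Complex.
Variable R : realType.
Implicit Types a b : R[i].

Lemma ler_addgt0 (x y : R) : (forall e : R, 0 < e -> x <= y + e) -> x <= y.
Proof. by move=> h; apply/ler_addgt0Pr. Qed.

Lemma ReD a b : Re (a + b) = Re a + Re b.
Proof. by case: a b => [? ?] [? ?]. Qed.

Lemma ReN a : Re (- a) = - Re a.
Proof. by case: a. Qed.

Lemma Re_conj a : Re a^* = Re a.
Proof. by case: a. Qed.

Lemma Re_mulC a b : Re (a * b) = Re a * Re b - Im a * Im b.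
Proof. by case: a b => [? ?] [? ?]. Qed.

Lemma Im_mulC a b : Im (a * b) = Re a * Im b + Im a * Re b.
Proof. by case: a b => [? ?] [? ?]. Qed.

Lemma Im_conj a : Im a^* = - Im a.
Proof. by case: a. Qed.

Lemma normc_ge0 a : 0 <= normc a.
Proof. by case: a => x y; exact: sqrtr_ge0. Qed.

Lemma normc_sqr a : normc a ^+ 2 = Re a ^+ 2 + Im a ^+ 2.
Proof. by case: a => x y /=; rewrite sqr_sqrtr // addr_ge0 ?sqr_ge0. Qed.

Lemma Re_le_normc a : Re a <= normc a.
Proof.
have := normc_ge0 a; have := normc_sqr a; move: (normc a) => n; nra.
Qed.

Lemma normc_real (x : R) : 0 <= x -> normc x%:C%C = x.
Proof. by move=> x0 /=; rewrite expr0n addr0 sqrtr_sqr ger0_norm. Qed.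

Lemma normc_gt0 a : (0 < normc a) = (a != 0).
Proof.
rewrite lt_def normc_ge0 andbT; congr negb; apply/eqP/eqP.
  exact: ComplexField.Normc.eq0_normc.
by move=> ->; exact: ComplexField.Normc.normc0.
Qed.

End Complex.

(** * Geometry of complex inner product spaces *)

Section InnerProduct.
Variables (R : realType) (V : lmodType R[i]) (ip : V -> V -> R[i]).
Hypothesis ipV : inner_product ip.
Implicit Types (x y z : V) (a : R[i]) (u : nat -> V).
Local Notation norm := (hnorm ip).

Lemma ipDl x y z : ip (x + y) z = ip x z + ip y z.
Proof. by have [h _ _ _] := ipV; have := h 1 x y z; rewrite scale1r mul1r. Qed.

Lemma ip0l z : ip 0 z = 0.
Proof. by apply: (addrI (ip 0 z)); rewrite -ipDl !addr0. Qed.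

Lemma ipZl a x z : ip (a *: x) z = a * ip x z.
Proof. by have [h _ _ _] := ipV; have := h a x 0 z; rewrite ip0l !addr0. Qed.

Lemma ipNl x z : ip (- x) z = - ip x z.
Proof. by rewrite -scaleN1r ipZl mulN1r. Qed.

Lemma ipBl x y z : ip (x - y) z = ip x z - ip y z.
Proof. by rewrite ipDl ipNl. Qed.

Lemma ip_conj x y : ip y x = (ip x y)^*.
Proof. by have [_ h _ _] := ipV. Qed.

Lemma ipDr x y z : ip z (x + y) = ip z x + ip z y.
Proof. by rewrite ip_conj ipDl rmorphD /= -!ip_conj. Qed.

Lemma ipZr a x z : ip z (a *: x) = a^* * ip z x.
Proof. by rewrite ip_conj ipZl rmorphM /= -ip_conj. Qed.

Lemma ipNr x z : ip z (- x) = - ip z x.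
Proof. by rewrite ip_conj ipNl rmorphN /= -ip_conj. Qed.

Lemma Re_ipC x y : Re (ip y x) = Re (ip x y).
Proof. by rewrite ip_conj Re_conj. Qed.

Lemma hnorm_ge0 x : 0 <= norm x.
Proof. exact: sqrtr_ge0. Qed.

Lemma hnorm_sqr x : norm x ^+ 2 = Re (ip x x).
Proof.
have [_ _ h _] := ipV; rewrite sqr_sqrtr //.
by have := h x; rewrite lecE => /andP[].
Qed.

Lemma ip_self x : ip x x = (norm x ^+ 2)%:C%C.
Proof.
have [_ _ h _] := ipV; rewrite hnorm_sqr.
by have := h x; rewrite lecE => /andP[/eqP]; case: (ip x x) => a b /= -> _.
Qed.

Lemma hnorm_eq0 x : norm x = 0 -> x = 0.
Proof.
by have [_ _ _ h] := ipV; move=> x0; apply: h; rewrite ip_self x0 expr0n.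
Qed.

Lemma hnorm0 : norm 0 = 0.
Proof. by rewrite /hnorm ip0l sqrtr0. Qed.

Lemma hnorm_sqrD x y :
  norm (x + y) ^+ 2 = norm x ^+ 2 + 2 * Re (ip x y) + norm y ^+ 2.
Proof.
by rewrite !hnorm_sqr ipDl !ipDr !ReD [Re (ip y x)]Re_ipC; ring.
Qed.

Lemma hnormN x : norm (- x) = norm x.
Proof. by rewrite /hnorm ipNl ipNr opprK. Qed.

Lemma hnormBC x y : norm (x - y) = norm (y - x).
Proof. by rewrite -hnormN opprB. Qed.

Lemma parallelogram x y :
  norm (x + y) ^+ 2 + norm (x - y) ^+ 2 = 2 * norm x ^+ 2 + 2 * norm y ^+ 2.
Proof. by rewrite !hnorm_sqrD ipNr ReN hnormN; ring. Qed.

Lemma hnormZ a x : norm (a *: x) = normc a * norm x.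
Proof.
apply/eqP; rewrite -(@eqrXn2 _ 2) ?mulr_ge0 ?normc_ge0 ?hnorm_ge0 //.
rewrite hnorm_sqr ipZl ipZr exprMn normc_sqr ip_self !Re_mulC !Im_mulC.
by rewrite Re_conj Im_conj /=; apply/eqP; ring.
Qed.

Lemma cauchy_schwarz x y : normc (ip x y) <= norm x * norm y.
Proof.
have [->|y0] := eqVneq y 0.
  by rewrite ip_conj ip0l rmorph0 ComplexField.Normc.normc0 hnorm0 mulr0.
have ny : 0 < norm y.
  by rewrite lt_def hnorm_ge0 andbT; apply: contra_neq y0 => /hnorm_eq0.
rewrite -(@ler_pXn2r _ 2) ?nnegrE ?mulr_ge0 ?normc_ge0 ?hnorm_ge0 //.
(* The usual vector [x - (<x, y> / ||y||^2) y], multiplied by [||y||^2] to avoid division. Its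
   squared norm is [n * (n * s - |<x, y>|^2)] with [n], [s] the squared norms of [y], [x]. *)
have := sqr_ge0 (norm ((norm y ^+ 2)%:C%C *: x - ip x y *: y)).
rewrite hnorm_sqrD hnormN !hnormZ !exprMn normc_real ?sqr_ge0 //.
rewrite ipNr ReN ipZl ipZr !Re_mulC Re_conj !Im_conj Im_mulC /= exprMn.
rewrite normc_sqr.
set n := norm y ^+ 2; have n0 : 0 < n by rewrite exprn_gt0.
set s := norm x ^+ 2; rewrite Re_conj Im_conj => h.
rewrite -(ler_pM2l n0); nra.
Qed.

Lemma Re_ip_le x y : Re (ip x y) <= norm x * norm y.
Proof. exact: le_trans (Re_le_normc _) (cauchy_schwarz _ _). Qed.

Lemma hnormD x y : norm (x + y) <= norm x + norm y.
Proof.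
rewrite -(@ler_pXn2r _ 2) ?nnegrE ?addr_ge0 ?hnorm_ge0 // hnorm_sqrD.
have := Re_ip_le x y; nra.
Qed.

Lemma hnormB_le x y z : norm (x - z) <= norm (x - y) + norm (y - z).
Proof. by rewrite -[x - z](subrKA y) hnormD. Qed.

(** This is the form in which parallelogram laws deliver Cauchyness: [u n] minimizes up to
    [1 / (n + 1)], and squared distances are controlled by the sum of the two errors. *)
Lemma hcauchy_sqr u (K : R) :
  (forall m n, norm (u m - u n) ^+ 2 <= K * (m.+1%:R^-1 + n.+1%:R^-1)) ->
  hcauchy ip u.
Proof.
move=> h e e0.
exists (Num.truncn (2 * K / e ^+ 2)) => m n hm hn.
rewrite -(@ltr_pXn2r _ 2) ?nnegrE ?hnorm_ge0 ?ltW //.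
apply: le_lt_trans (h m n) _.
have e2 : 0 < e ^+ 2 by rewrite exprn_gt0.
have H k : (Num.truncn (2 * K / e ^+ 2) <= k)%N -> K * k.+1%:R^-1 < e ^+ 2 / 2.
  move=> hk; rewrite ltr_pdivrMr // mulrAC ltr_pdivlMr // mulrC.
  have : 2 * K / e ^+ 2 < k.+1%:R.
    by apply: lt_le_trans (truncnS_gt _) _; rewrite ler_nat.
  by rewrite ltr_pdivrMr // [_ * e ^+ 2]mulrC.
by rewrite mulrDr [ltRHS]splitr ltrD // H.
Qed.

End InnerProduct.

(** * Orthogonal projections onto closed subspaces and their distance *)

Section Projection.
Variables (R : realType) (V : lmodType R[i]) (ip : V -> V -> R[i]).
Hypotheses (ipV : inner_product ip) (cV : hcomplete ip).
Local Notation norm := (hnorm ip).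

Lemma orthogonal_of_min (M : set V) (w m : V) :
  lin_subspace M -> (forall m', M m' -> norm w <= norm (w - m')) ->
  M m -> ip w m = 0.
Proof.
move=> [M0 lM] wmin Mm.
have MZ a : M (a *: m) by rewrite -[_ *: _]addr0; exact: lM.
(* Test minimality against [t <w, m> m] with [t = 1 / (||m||^2 + 1)]; the [+ 1] also covers [m = 0].
   With [q = |<w, m>|^2] and [t ||m||^2 = 1 - t], it yields [q t (1 + t) <= 0], hence [q = 0]. *)
have := wmin _ (MZ ((norm m ^+ 2 + 1)^-1%:C%C * ip w m)).
rewrite -(@ler_pXn2r _ 2) ?nnegrE ?hnorm_ge0 //.
rewrite hnorm_sqrD // ipNr // ReN ipZr // hnormN // hnormZ //.
rewrite !exprMn normc_sqr Re_mulC Re_conj Im_conj Re_mulC Im_mulC /=.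
move: (sqr_ge0 (norm m)); set n := norm m ^+ 2 => n0.
have t0 : 0 < (n + 1)^-1 by rewrite invr_gt0; lra.
have tn : (n + 1)^-1 * n = 1 - (n + 1)^-1 by field; lra.
set t := (n + 1)^-1 in t0 tn *.
move=> h; apply: ComplexField.Normc.eq0_normc.
apply/eqP; rewrite -sqrf_eq0 normc_sqr; set q := _ + _.
have q0 : 0 <= q by rewrite addr_ge0 ?sqr_ge0.
have : q * t * (1 + t) <= 0.
  have -> : q * t * (1 + t) = 2 * (t * q) - t * q * (t * n) by rewrite tn; ring.
  rewrite /q; nra.
rewrite eq_le q0 andbT pmulr_lle0; last by lra.
by rewrite pmulr_lle0.
Qed.

Lemma orth_proj_exists (M : set V) (z : V) :
  lin_subspace M ->
  (forall u x, (forall n, M (u n)) -> hconv ip u x -> M x) ->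
  exists p, M p /\ forall m, M m -> ip (z - p) m = 0.
Proof.
move=> lM closedM; have [M0 lM'] := lM.
pose E := [set norm (z - m) | m in M].
have lbE : lbound E 0 by move=> _ [m _ <-]; exact: hnorm_ge0.
have infE : has_inf E by split; [exists (norm (z - 0)), 0 | exists 0].
set d := inf E.
have d_le m : M m -> d <= norm (z - m).
  by move=> Mm; apply: ge_inf; [exists 0 | exists m].
have d0 : 0 <= d by apply: lb_le_inf => //; case: infE.
have /choice[u uP] n : exists v, M v /\ norm (z - v) < d + n.+1%:R^-1.
  have [//|_ [m Mm <-] hm] := @inf_adherent _ E n.+1%:R^-1 _ infE.
    by rewrite invr_gt0.
  by exists m.
have [l ul] : exists l, hconv ip u l.
  apply: cV.
  (* The midpoint of [u i] and [u j] is in [M], so it is at distance at least [d] from [z]. Since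
     [(d + a)^2 <= d^2 + (2 d + 1) a] for [0 < a <= 1], the parallelogram law gives the constant
     [4 d + 2], rounded up here. *)
  apply: (@hcauchy_sqr _ _ _ u (4 * d + 4)) => i j.
  have [Mi hi] := uP i; have [Mj hj] := uP j.
  have Mij : M (2^-1 *: (u i + u j)).
    rewrite -[_ *: _]addr0; apply: (lM') => //.
    by rewrite -[u i]scale1r; apply: (lM').
  have := d_le _ Mij; have := parallelogram ipV (z - u i) (z - u j).
  have -> : z - u i - (z - u j) = u j - u i.
    by rewrite opprB addrC subrKA.
  have -> : z - u i + (z - u j) = 2 *: (z - 2^-1 *: (u i + u j)).
    rewrite scalerBr scalerA divff ?pnatr_eq0 // scale1r.
    by rewrite scaler_nat mulr2n opprD addrACA.
  rewrite hnormZ // exprMn hnormBC //.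
  have -> : normc (2 : R[i]) = 2.
    by rewrite -[2 : R[i]](rmorph_nat (real_complex R)) normc_real.
  have bnd k : 0 < (k.+1%:R^-1 : R) <= 1.
    by rewrite invr_gt0 ltr0Sn invf_le1 ?ltr0Sn ?ler1n.
  move: (bnd i) (bnd j) hi hj (hnorm_ge0 ip (z - u i)) (hnorm_ge0 ip (z - u j)).
  move: (norm (z - u i)) (norm (z - u j)) (norm (u j - u i))
    (norm (z - 2^-1 *: (u i + u j))).
  move: (i.+1%:R^-1) (j.+1%:R^-1) => a b p q r s.
  move=> /andP[a0 a1] /andP[b0 b1] pa qb p0 q0 h ds.
  have : p ^+ 2 <= d ^+ 2 + (2 * d + 1) * a by nra.
  have : q ^+ 2 <= d ^+ 2 + (2 * d + 1) * b by nra.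
  have : d ^+ 2 <= s ^+ 2 by nra.
  nra.
exists l; split; first by apply: closedM ul => n; have [] := uP n.
move=> m Mm; apply: orthogonal_of_min Mm => // m' Mm'.
have -> : z - l - m' = z - (l + m') by rewrite opprD addrA.
(* The limit realizes the distance: [||z - l|| <= d], while [l + m'] is in [M] and so is no closer
   to [z] than [d]. *)
apply: (@le_trans _ _ d); last first.
  apply: d_le; rewrite -[l]scale1r; apply: (lM') => //.
  by apply: closedM ul => n; have [] := uP n.
apply: ler_addgt0 => e e0.
have [N hN] := ul (e / 2) ltac:(lra).
pose k := maxn N (Num.truncn (2 / e)).
have := hN k (leq_maxl _ _); have [_] := uP k.
have : k.+1%:R^-1 < e / 2.
  rewrite -[e / 2]invf_div ltf_pV2 ?posrE ?divr_gt0 //.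
  by apply: lt_le_trans (truncnS_gt _) _; rewrite ler_nat ltnS leq_maxr.
have := hnormB_le ipV z (u k) l.
rewrite -/k; move: (k.+1%:R^-1 : R) => a; lra.
Qed.

Lemma hnorm_orth_proj (z p : V) : ip (z - p) p = 0 ->
  norm z ^+ 2 = norm (z - p) ^+ 2 + norm p ^+ 2.
Proof.
move=> zp; have := hnorm_sqrD ipV (z - p) p.
by rewrite subrK zp mulr0 addr0.
Qed.

(** Write [||p - q||^2 = Re <p - q, p> + Re <q - p, q>]. As [z - p] is orthogonal to [p] and [z - q]
    to [N], [<p - q, p> = <z - q, p> = <z - q, p - p'>] for [p'] in [N] near [p], which
    Cauchy-Schwarz bounds by [s]. The other term is symmetric. *)
Lemma dist_orth_proj (M N : set V) (z p q : V) (s : R) :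
  0 <= s -> norm z <= 1 ->
  M p -> (forall m, M m -> ip (z - p) m = 0) ->
  N q -> (forall n, N n -> ip (z - q) n = 0) ->
  (forall m, M m -> exists2 n, N n & norm (m - n) <= s * norm m) ->
  (forall n, N n -> exists2 m, M m & norm (n - m) <= s * norm n) ->
  norm (p - q) ^+ 2 <= 2 * s.
Proof.
move=> s0 z1 Mp zp Nq zq MN NM.
have half (a b b' : V) : ip (z - a) a = 0 -> ip (z - b) b = 0 ->
    ip (z - b) b' = 0 -> norm (a - b') <= s * norm a ->
    Re (ip (a - b) a) <= s.
  move=> za zb zb' ab'.
  have -> : ip (a - b) a = ip (z - b) (a - b').
    have := ipDl ipV (z - a) (a - b) a.
    by rewrite subrKA za add0r ipDr // ipNr // zb' subr0.
  apply: le_trans (Re_ip_le ipV _ _) _.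
  have := hnorm_orth_proj za; have := hnorm_orth_proj zb.
  have := hnorm_ge0 ip z; have := hnorm_ge0 ip a.
  have := hnorm_ge0 ip (z - b); have := hnorm_ge0 ip (a - b').
  move: z1 ab'; move: (norm z) (norm a) (norm (z - b)) (norm (a - b')).
  move=> t u v w t1 wu w0 v0 u0 t0 tv tu.
  have u1 : u <= 1 by nra.
  have v1 : v <= 1 by nra.
  apply: (@le_trans _ _ w); first by rewrite ler_piMl.
  by apply: le_trans wu _; rewrite ler_piMr.
have [p' Np' pp'] := MN _ Mp; have [q' Mq' qq'] := NM _ Nq.
have := half _ _ _ (zp _ Mp) (zq _ Nq) (zq _ Np') pp'.
have := half _ _ _ (zq _ Nq) (zp _ Mp) (zp _ Mq') qq'.
rewrite hnorm_sqr // [ip (p - q) (p - q)]ipDr // ipNr // ReD ReN.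
by rewrite -[q - p]opprB ipNl // ReN; lra.
Qed.

End Projection.

(** * The product Hilbert space, projections onto graphs, and the gap *)

Section Graph.
Variables (R : realType) (H1 H2 : lmodType R[i]).
Variables (ip1 : H1 -> H1 -> R[i]) (ip2 : H2 -> H2 -> R[i]).
Hypotheses (hip1 : inner_product ip1) (hip2 : inner_product ip2).
Local Notation P := (H2 * H1)%type.
Local Notation ipP := (pip ip1 ip2 : P -> P -> R[i]).

Lemma pip_inner_product : inner_product ipP.
Proof.
split=> [a x y z|x y|x|[x1 x2]].
- rewrite /pip /= (ipDl hip2) (ipDl hip1) (ipZl hip2) (ipZl hip1); ring.
- by rewrite /pip rmorphD /= -(ip_conj hip2) -(ip_conj hip1).
- by rewrite addr_ge0 //; [case: hip2|case: hip1].
- rewrite /pip /= (ip_self hip2) (ip_self hip1) -rmorphD => /(congr1 (@complex.Re R)) /= h.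
  have /eqP := h; rewrite paddr_eq0 ?sqr_ge0 // !sqrf_eq0 => /andP[/eqP h1 /eqP h2].
  by rewrite (hnorm_eq0 hip2 h1) (hnorm_eq0 hip1 h2).
Qed.

Lemma hnorm_pip_sqr (z : P) :
  hnorm ipP z ^+ 2 = hnorm ip2 z.1 ^+ 2 + hnorm ip1 z.2 ^+ 2.
Proof.
rewrite (hnorm_sqr pip_inner_product) (hnorm_sqr hip2) (hnorm_sqr hip1).
exact: ReD.
Qed.

Lemma hnorm_fst_le (z : P) : hnorm ip2 z.1 <= hnorm ipP z.
Proof.
have := hnorm_pip_sqr z; have := hnorm_ge0 ip1 z.2.
have := hnorm_ge0 ip2 z.1; have := hnorm_ge0 ipP z; nra.
Qed.

Lemma hnorm_snd_le (z : P) : hnorm ip1 z.2 <= hnorm ipP z.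
Proof.
have := hnorm_pip_sqr z; have := hnorm_ge0 ip1 z.2.
have := hnorm_ge0 ip2 z.1; have := hnorm_ge0 ipP z; nra.
Qed.

Lemma hnorm_pip_le (z : P) : hnorm ipP z <= hnorm ip2 z.1 + hnorm ip1 z.2.
Proof.
have := hnorm_pip_sqr z; have := hnorm_ge0 ip1 z.2.
have := hnorm_ge0 ip2 z.1; have := hnorm_ge0 ipP z; nra.
Qed.

Lemma hconv_fst (u : nat -> P) (z : P) :
  hconv ipP u z -> hconv ip2 (fst \o u) z.1.
Proof.
move=> uz e e0; have [N hN] := uz e e0; exists N => n /hN.
exact: le_lt_trans (hnorm_fst_le _).
Qed.

Lemma hconv_snd (u : nat -> P) (z : P) :
  hconv ipP u z -> hconv ip1 (snd \o u) z.2.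
Proof.
move=> uz e e0; have [N hN] := uz e e0; exists N => n /hN.
exact: le_lt_trans (hnorm_snd_le _).
Qed.

Lemma hcomplete_pip : hcomplete ip1 -> hcomplete ip2 -> hcomplete ipP.
Proof.
move=> c1 c2 u cu.
have [x ux] : exists x, hconv ip1 (snd \o u) x.
  apply: c1 => e e0; have [N hN] := cu e e0; exists N => m n hm hn.
  exact: le_lt_trans (hnorm_snd_le _) (hN _ _ hm hn).
have [y uy] : exists y, hconv ip2 (fst \o u) y.
  apply: c2 => e e0; have [N hN] := cu e e0; exists N => m n hm hn.
  exact: le_lt_trans (hnorm_fst_le _) (hN _ _ hm hn).
exists (y, x) => e e0.
have [N1 hN1] := ux (e / 2) ltac:(lra); have [N2 hN2] := uy (e / 2) ltac:(lra).
exists (maxn N1 N2) => n; rewrite geq_max => /andP[/hN1 h1 /hN2 h2].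
apply: le_lt_trans (hnorm_pip_le _) _.
by rewrite [e]splitr ltrD.
Qed.

Section Gap.
Hypotheses (c1 : hcomplete ip1) (c2 : hcomplete ip2).

(** [orth_proj] is a choice with default [(0, 0)], so it has the projection property as soon as some
    point has it. The graph is a closed subspace because the operator is linear and closed. *)
Lemma graph_orth_proj (D : set H1) (T : H1 -> H2) (z : P) :
  lin_subspace D -> linear_on D T -> closed_op ip1 ip2 D T ->
  graph D T (orth_proj ip1 ip2 (graph D T) z) /\
  forall m, graph D T m -> ipP (z - orth_proj ip1 ip2 (graph D T) z) m = 0.
Proof.
move=> [D0 lD] lT cT.
pose Q := [set p | graph D T p /\
  forall m, graph D T m -> pip ip1 ip2 (psub z p) m = 0].
suff : exists p, Q p by move=> /(xgetPex (0, 0)).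
apply: (orth_proj_exists pip_inner_product (hcomplete_pip c1 c2)).
- split.
    exists 0; split=> //; congr pair.
    have := lT 1 0 0 D0 D0; rewrite !scale1r addr0 => h.
    by apply: (addrI (T 0)); rewrite addr0 -h.
  move=> a _ _ [x [Dx ->]] [y [Dy ->]].
  by exists (a *: x + y); split; [exact: lD|rewrite lT].
- move=> u [y x] Du ul.
  have Tu : (T \o (snd \o u)) = (fst \o u).
    by apply: funext => n /=; have [v [_ ->]] := Du n.
  have [||Dx Tx] := cT _ _ y _ (hconv_snd ul).
  + by move=> n /=; have [v [Dv ->]] := Du n.
  + by rewrite Tu; exact: hconv_fst ul.
  + by exists x; split=> //; rewrite Tx.
Qed.

(** Pairing [(T x, x)] with [(T' x, x)] moves a graph point by at most [s ||x||], hence by at most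
    [s] times its own norm; [dist_orth_proj] then applies in both directions. *)
Lemma gap_le (D : set H1) (T T' : H1 -> H2) (s e : R) :
  lin_subspace D -> linear_on D T -> closed_op ip1 ip2 D T ->
  linear_on D T' -> closed_op ip1 ip2 D T' ->
  0 <= s -> 0 <= e -> 2 * s <= e ^+ 2 ->
  (forall x, D x -> hnorm ip2 (T x - T' x) <= s * hnorm ip1 x) ->
  gap ip1 ip2 D T D T' <= e.
Proof.
move=> lD lT cT lT' cT' s0 e0 se TT'.
apply: ge_sup.
  (* The image of [0] shows that the set under the supremum is nonempty; [pnorm] is convertible to
     [hnorm] of [pip]. *)
  eexists; exists 0; last by [].
  by change (hnorm ipP 0 <= 1); rewrite (hnorm0 pip_inner_product).
move=> _ [z z1 <-].
have [Tp Tz] := graph_orth_proj z lD lT cT.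
have [Tp' Tz'] := graph_orth_proj z lD lT' cT'.
rewrite -(@ler_pXn2r _ 2) ?nnegrE ?hnorm_ge0 //; apply: le_trans se.
have near (A B : H1 -> H2) :
    (forall x, D x -> hnorm ip2 (A x - B x) <= s * hnorm ip1 x) ->
    forall m, graph D A m ->
    exists2 n, graph D B n & hnorm ipP (m - n) <= s * hnorm ipP m.
  move=> AB _ [x [Dx ->]]; exists (B x, x); first by exists x.
  apply: le_trans (hnorm_pip_le _) _; rewrite /= subrr hnorm0 // addr0.
  apply: le_trans (AB _ Dx) _; apply: ler_wpM2l => //.
  exact: hnorm_snd_le (A x, x).
apply: (dist_orth_proj pip_inner_product s0 z1 Tp Tz Tp' Tz'); apply: near => //.
by move=> x Dx; rewrite hnormBC //; exact: TT'.
Qed.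

End Gap.
End Graph.

(** * The minimum modulus of a linear operator *)

Section MinModulus.
Variables (R : realType) (H1 H2 : lmodType R[i]).
Variables (ip1 : H1 -> H1 -> R[i]) (ip2 : H2 -> H2 -> R[i]).
Hypotheses (hip1 : inner_product ip1) (hip2 : inner_product ip2).
Variables (D : set H1) (T : H1 -> H2).
Hypotheses (lD : lin_subspace D) (lT : linear_on D T).
Local Notation m := (min_modulus ip1 ip2 D T).

Lemma lin_subspaceZ a x : D x -> D (a *: x).
Proof. by case: lD => D0 h Dx; rewrite -[_ *: _]addr0; apply: h. Qed.

Lemma lin_subspaceD x y : D x -> D y -> D (x + y).
Proof. by case: lD => _ h Dx Dy; rewrite -[x]scale1r; apply: h. Qed.

Lemma lin_subspaceB x y : D x -> D y -> D (x - y).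
Proof.
by move=> Dx Dy; apply: lin_subspaceD => //; rewrite -scaleN1r; apply: lin_subspaceZ.
Qed.

Lemma linear_onD x y : D x -> D y -> T (x + y) = T x + T y.
Proof. by move=> Dx Dy; have := lT 1 Dx Dy; rewrite !scale1r. Qed.

Lemma linear_on0 : T 0 = 0.
Proof.
case: lD => D0 _; apply: (addrI (T 0)).
by rewrite -linear_onD // !addr0.
Qed.

Lemma linear_onZ a x : D x -> T (a *: x) = a *: T x.
Proof.
move=> Dx; case: lD => D0 _.
by have := lT a Dx D0; rewrite linear_on0 !addr0.
Qed.

Lemma linear_onB x y : D x -> D y -> T (x - y) = T x - T y.
Proof.
move=> Dx Dy; rewrite -[- y]scaleN1r linear_onD //; last exact: lin_subspaceZ.
by rewrite linear_onZ // scaleN1r.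
Qed.

Lemma normalize (x : H1) : D x -> x != 0 ->
  D ((hnorm ip1 x)^-1%:C%C *: x) /\ hnorm ip1 ((hnorm ip1 x)^-1%:C%C *: x) = 1.
Proof.
move=> Dx x0; split; first exact: lin_subspaceZ.
rewrite hnormZ // normc_real ?invr_ge0 ?hnorm_ge0 // mulVf //.
by apply: contra_neq x0; exact: hnorm_eq0.
Qed.

Lemma min_modulus_le x : D x -> m * hnorm ip1 x <= hnorm ip2 (T x).
Proof.
move=> Dx; have [->|x0] := eqVneq x 0.
  by rewrite linear_on0 !hnorm0 // mulr0.
have nx : 0 < hnorm ip1 x.
  by rewrite lt_def hnorm_ge0 andbT; apply: contra_neq x0; exact: hnorm_eq0.
have [Dy y1] := normalize Dx x0.
have : m <= hnorm ip2 (T ((hnorm ip1 x)^-1%:C%C *: x)).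
  apply: ge_inf; last by exists ((hnorm ip1 x)^-1%:C%C *: x).
  by exists 0 => _ [y _ <-]; exact: hnorm_ge0.
rewrite linear_onZ // hnormZ // normc_real ?invr_ge0 ?hnorm_ge0 //.
by rewrite ler_pdivlMl // mulrC.
Qed.

Hypothesis unitD : exists x, D x /\ hnorm ip1 x = 1.

Lemma min_modulus_ge c :
  (forall x, D x -> c * hnorm ip1 x <= hnorm ip2 (T x)) -> c <= m.
Proof.
(* A unit vector in [D] makes the set of values nonempty, so that [inf] is its greatest lower bound
   and not a default value. *)
move=> h; have [x Dx] := unitD; apply: lb_le_inf.
  by exists (hnorm ip2 (T x)), x.
by move=> _ [y [Dy y1] <-]; have := h _ Dy; rewrite y1 mulr1.
Qed.

Lemma min_modulus_ge0 : 0 <= m.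
Proof. by apply: min_modulus_ge => x _; rewrite mul0r hnorm_ge0. Qed.

Lemma min_modulus_approx e : 0 < e ->
  exists x, [/\ D x, hnorm ip1 x = 1 & hnorm ip2 (T x) < m + e].
Proof.
pose E := [set hnorm ip2 (T x) | x in [set x | D x /\ hnorm ip1 x = 1]].
move=> e0; have [|_ [x [Dx x1] <-] h] := @inf_adherent _ E _ e0.
  have [x Dx] := unitD; split; first by exists (hnorm ip2 (T x)), x.
  by exists 0 => _ [y _ <-]; exact: hnorm_ge0.
by exists x.
Qed.

End MinModulus.

(** * Rank-one perturbations and attainment of the minimum modulus *)

Section Perturbation.
Variables (R : realType) (H1 H2 : lmodType R[i]).
Variables (ip1 : H1 -> H1 -> R[i]) (ip2 : H2 -> H2 -> R[i]).
Hypotheses (hip1 : inner_product ip1) (hip2 : inner_product ip2).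
Hypotheses (c1 : hcomplete ip1) (c2 : hcomplete ip2).
Variables (D : set H1) (T : H1 -> H2).
Hypothesis ddcT : densely_defined_closed ip1 ip2 D T.

(** The final theorem takes [w = - eta T x0]; closedness and the attainment criterion are proved for
    arbitrary [w]. *)
Definition rank_one_perturb (x0 : H1) (w : H2) (x : H1) : H2 :=
  T x + ip1 x x0 *: w.

Variables (x0 : H1) (w : H2).
Local Notation T' := (rank_one_perturb x0 w).

Lemma hnorm_rank_one x :
  hnorm ip2 (ip1 x x0 *: w) <= hnorm ip1 x0 * hnorm ip2 w * hnorm ip1 x.
Proof.
rewrite hnormZ // mulrAC [hnorm ip1 x0 * _]mulrC.
by apply: ler_wpM2r; [exact: hnorm_ge0 | exact: cauchy_schwarz].
Qed.

(** The added term is bounded, so if [u n] tends to [x] and [T' (u n)] to [y], then [T (u n)] tends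
    to [y - <x, x0> w], and closedness of [T] applies. *)
Lemma rank_one_perturb_closed : densely_defined_closed ip1 ip2 D T'.
Proof.
have [lD dD lT cT] := ddcT; split=> //.
  move=> a x y Dx Dy; rewrite /rank_one_perturb lT // ipDl // ipZl //.
  by rewrite scalerDl scalerDr scalerA addrACA.
move=> u x y Du ux uy; set C := hnorm ip1 x0 * hnorm ip2 w.
have C0 : 0 <= C by rewrite mulr_ge0 ?hnorm_ge0.
have [//||Dx Tx] := cT u x (y - ip1 x x0 *: w) _ ux.
  move=> e e0.
  have d0 : 0 < e / 2 / (C + 1) by rewrite !divr_gt0 //; lra.
  have [N1 hN1] := ux _ d0; have [N2 hN2] := uy (e / 2) ltac:(lra).
  exists (maxn N1 N2) => n; rewrite geq_max => /andP[/hN1 h1 /hN2 h2].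
  have -> : (T \o u) n - (y - ip1 x x0 *: w) =
      ((T' \o u) n - y) - ip1 (u n - x) x0 *: w.
    rewrite /= /rank_one_perturb ipBl // scalerBl !opprB.
    rewrite [_ + _ - y]addrAC -[RHS]addrA [LHS]addrCA [LHS]addrC.
    by congr (_ + _); rewrite addrC subrK.
  apply: le_lt_trans (hnormD hip2 _ _) _; rewrite hnormN //.
  have := hnorm_rank_one (u n - x); rewrite -/C.
  have : hnorm ip1 (u n - x) * (C + 1) < e / 2 by rewrite -ltr_pdivlMr //; lra.
  move: h2 (hnorm_ge0 ip1 (u n - x)) => /=; nra.
by split=> //; rewrite /rank_one_perturb Tx subrK.
Qed.

(* Coercivity of the form [Q] on a hyperplane makes [Q]-minimizing sequences in
   a parallel affine hyperplane Cauchy, without any weak compactness. *)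
Lemma coercive_form_zero (k q : R) (S : H1 -> H2) :
  lin_subspace D -> linear_on D S -> closed_op ip1 ip2 D S -> 0 < k -> 0 <= q ->
  let Q x := hnorm ip2 (S x) ^+ 2 - q * hnorm ip1 x ^+ 2 in
  (forall x, D x -> 0 <= Q x) ->
  (forall x, D x -> ip1 x x0 = 0 -> k * hnorm ip1 x ^+ 2 <= Q x) ->
  (forall e, 0 < e -> exists z, [/\ D z, ip1 z x0 = 1 & Q z < e]) ->
  exists z, [/\ D z, z != 0 & Q z = 0].
Proof.
move=> lD lS cS k0 q0 Q Q0 Qk Qe.
(* The parallelogram law for [Q], with the nonnegative term [Q (x + y)] dropped. *)
have Qpar x y : D x -> D y -> Q (x - y) <= 2 * Q x + 2 * Q y.
  move=> Dx Dy; have := Q0 _ (lin_subspaceD lD Dx Dy).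
  have := parallelogram hip1 x y; have := parallelogram hip2 (S x) (S y).
  rewrite /Q (linear_onB lD lS) // (linear_onD lS) //.
  move=> h1 h2; rewrite -subr_ge0 => h.
  have -> : hnorm ip2 (S x - S y) ^+ 2 = 2 * hnorm ip2 (S x) ^+ 2 +
    2 * hnorm ip2 (S y) ^+ 2 - hnorm ip2 (S x + S y) ^+ 2 by lra.
  have -> : hnorm ip1 (x - y) ^+ 2 = 2 * hnorm ip1 x ^+ 2 +
    2 * hnorm ip1 y ^+ 2 - hnorm ip1 (x + y) ^+ 2 by lra.
  rewrite -subr_ge0; move: h; congr (0 <= _); ring.
have /choice[u uP] n : exists z, [/\ D z, ip1 z x0 = 1 & Q z < n.+1%:R^-1].
  by apply: Qe; rewrite invr_gt0.
have Quu i j : Q (u i - u j) <= 2 * (i.+1%:R^-1 + j.+1%:R^-1).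
  have [Di _ hi] := uP i; have [Dj _ hj] := uP j.
  apply: le_trans (Qpar _ _ Di Dj) _; rewrite [leRHS]mulrDr.
  by apply: lerD; rewrite ler_pM2l ?ltW.
(* Both vectors have inner product 1 with [x0], so their difference lies in the hyperplane where [Q]
   is coercive. *)
have uk i j : k * hnorm ip1 (u i - u j) ^+ 2 <= Q (u i - u j).
  have [Di xi _] := uP i; have [Dj xj _] := uP j.
  by apply: Qk; [exact: (lin_subspaceB lD) | rewrite ipBl // xi xj subrr].
have [z uz] : exists z, hconv ip1 u z.
  apply: c1; apply: (@hcauchy_sqr _ _ _ _ (k^-1 * 2)) => i j.
  by rewrite -mulrA ler_pdivlMl //; apply: le_trans (Quu i j).
have [y uy] : exists y, hconv ip2 (S \o u) y.
  (* On these differences [||S v||^2 = Q v + q ||v||^2 <= (1 + q / k) Q v]. *)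
  apply: c2; apply: (@hcauchy_sqr _ _ _ _ ((1 + q / k) * 2)) => i j.
  have [Di _ _] := uP i; have [Dj _ _] := uP j.
  rewrite -mulrA /= -(linear_onB lD lS) //.
  have -> : hnorm ip2 (S (u i - u j)) ^+ 2 =
    Q (u i - u j) + q * hnorm ip1 (u i - u j) ^+ 2 by rewrite /Q subrK.
  have := Quu i j; have := uk i j.
  have := sqr_ge0 (hnorm ip1 (u i - u j)).
  move: (_ ^+ 2) (Q _) (2 * _) => r s t r0 krs st.
  rewrite mulrDl mul1r; apply: lerD => //.
  rewrite -mulrA ler_wpM2l // ler_pdivlMl //; exact: le_trans st.
have [|Dz Sz] := cS u z y _ uz uy; first by move=> n; have [] := uP n.
(* The normalization survives in the limit by Cauchy-Schwarz; this is what keeps [z] away from 0. *)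
have z1 : ip1 z x0 = 1.
  apply/eqP; rewrite -subr_eq0; apply/eqP.
  apply: ComplexField.Normc.eq0_normc; apply/eqP.
  rewrite eq_le normc_ge0 andbT; apply: ler_addgt0 => e e0; rewrite add0r.
  have [|N hN] := uz (e / (hnorm ip1 x0 + 1)).
    by rewrite divr_gt0 // ltr_wpDl ?hnorm_ge0.
  have [_ uN _] := uP N.
  rewrite -uN -ipBl //; apply: le_trans (cauchy_schwarz hip1 _ _) _.
  have := hN _ (leqnn N); rewrite ltr_pdivlMr ?ltr_wpDl ?hnorm_ge0 //.
  rewrite hnormBC //.
  have := hnorm_ge0 ip1 (z - u N); nra.
exists z; split=> //.
  apply/eqP => z0; move: z1; rewrite z0 ip0l // => /eqP.
  by rewrite eq_sym oner_eq0.
apply/eqP; rewrite eq_le Q0 // andbT; apply: ler_addgt0 => e e0; rewrite add0r.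
(* Apply [Qpar] to [z = u n - (u n - z)]: both [Q (u n)] and [Q (u n - z) <= ||S (u n) - y||^2] fall
   below [e / 4]. The bound 1 turns [r < e / 4] into [r^2 < e / 4]. *)
have d0 : 0 < Num.min 1 (e / 4) by rewrite lt_min ltr01; lra.
have [N1 hN1] := uy _ d0.
pose n := maxn N1 (Num.truncn (4 / e)).
have := hN1 n (leq_maxl _ _); rewrite lt_min /= => /andP[r1 re].
have [Dn _ hn] := uP n.
have n1 : n.+1%:R^-1 < e / 4.
  rewrite -[e / 4]invf_div ltf_pV2 ?posrE ?divr_gt0 //.
  by apply: lt_le_trans (truncnS_gt _) _; rewrite ler_nat ltnS leq_maxr.
have Dnz := lin_subspaceB lD Dn Dz.
have := Qpar _ _ Dn Dnz; rewrite subKr.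
have : Q (u n - z) <= hnorm ip2 (S (u n) - y) ^+ 2.
  by rewrite /Q (linear_onB lD lS) // Sz gerBl mulr_ge0 ?sqr_ge0.
move: hn n1 r1 re (hnorm_ge0 ip2 (S (u n) - y)).
move: (Q _) (Q _) (Q _) (hnorm _ _) (_^-1) => a b c r t.
nra.
Qed.

(** [coercive_form_zero] is used with [q = m'^2] and [k = m^2 - m'^2]. The strict drop [m' < m]
    gives [k > 0] and also keeps near-minimizers of [T'] away from the hyperplane [<x, x0> = 0], so
    they can be rescaled. *)
Lemma rank_one_min_attaining :
  (exists x, D x /\ hnorm ip1 x = 1) ->
  min_modulus ip1 ip2 D T' < min_modulus ip1 ip2 D T ->
  min_attaining ip1 ip2 D T'.
Proof.
move=> unitD; set m' := min_modulus _ _ _ T'; set m := min_modulus _ _ _ T => mm.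
have [lD _ lT _] := ddcT.
have [_ _ lT' cT'] := rank_one_perturb_closed.
have m'0 : 0 <= m' by exact: min_modulus_ge0.
have m2 : 0 < m ^+ 2 - m' ^+ 2 by rewrite subr_gt0 ltrXn2r //; nra.
have [|||z [Dz z0 Qz]] :=
  @coercive_form_zero (m ^+ 2 - m' ^+ 2) (m' ^+ 2) T'
    lD lT' cT' m2 (sqr_ge0 _).
- move=> x Dx; rewrite subr_ge0 -exprMn ler_pXn2r ?nnegrE ?mulr_ge0 ?hnorm_ge0 //.
  exact: min_modulus_le.
- move=> x Dx xx0; rewrite /rank_one_perturb xx0 scale0r addr0 mulrBl lerD2r.
  rewrite -exprMn ler_pXn2r ?nnegrE ?mulr_ge0 ?hnorm_ge0 //; last first.
    exact: le_trans (ltW mm).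
  exact: min_modulus_le.
- suff H (e : R) : 0 < e -> exists z, [/\ D z, ip1 z x0 = 1
      & hnorm ip2 (T' z) ^+ 2 - m' ^+ 2 * hnorm ip1 z ^+ 2 < e] by exact: H.
  move=> e0; pose g := (m - m') / 2; pose a := g / (hnorm ip2 w + 1).
  have g0 : 0 < g by rewrite divr_gt0 // subr_gt0.
  have w0 : 0 < hnorm ip2 w + 1 by rewrite ltr_wpDl ?hnorm_ge0.
  have a0 : 0 < a by rewrite divr_gt0.
  have ga2 : g = a * (hnorm ip2 w + 1) by rewrite /a divfK // gt_eqF.
  have gE : m = m' + 2 * g by rewrite /g; lra.
  clearbody a g.
  (* For a unit [x] with [||T' x|| < m' + d], [d <= 1] gives [||T' x||^2 - m'^2 < (2 m' + 1) d <= e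
     a^2]. Rescaling divides this by [|<x, x0>|^2 >= a^2]. *)
  pose d := Num.min (Num.min g 1) (e * a ^+ 2 / (2 * m' + 1)).
  have h0 : 0 < e * a ^+ 2 / (2 * m' + 1).
    by rewrite !divr_gt0 ?mulr_gt0 ?exprn_gt0 // ltr_wpDl ?mulr_ge0.
  have d0 : 0 < d by rewrite !lt_min g0 ltr01 h0.
  have [x [Dx x1 T'x]] := min_modulus_approx ip2 T' unitD d0.
  rewrite -/m' in T'x.
  have dg : d <= g by rewrite !ge_min lexx.
  have d1 : d <= 1 by rewrite !ge_min lexx orbT.
  have de : (2 * m' + 1) * d <= e * a ^+ 2.
    rewrite mulrC -ler_pdivlMr ?ltr_wpDl ?mulr_ge0 //.
    by rewrite ge_min lexx orbT.
  (* From [m' + 2 g = m <= ||T x|| <= ||T' x|| + |<x, x0>| ||w||] and [||T' x|| < m' + g], one gets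
     [g < |<x, x0>| ||w||]. *)
  have xa : a <= normc (ip1 x x0).
    rewrite -(ler_pM2r w0) -ga2.
    have := min_modulus_le hip1 hip2 lD lT Dx; rewrite -/m x1 mulr1 => mT.
    have : hnorm ip2 (T x) <= hnorm ip2 (T' x) + normc (ip1 x x0) * hnorm ip2 w.
      rewrite -hnormZ // -[T x](addrK (ip1 x x0 *: w)).
      by apply: le_trans (hnormD hip2 _ _) _; rewrite hnormN.
    have := normc_ge0 (ip1 x x0); rewrite mulrDr mulr1.
    lra.
  have n0 : 0 < normc (ip1 x x0) by exact: lt_le_trans xa.
  have i0 : ip1 x x0 != 0 by rewrite -normc_gt0.
  exists ((ip1 x x0)^-1 *: x); split; first exact: lin_subspaceZ.
    by rewrite ipZl // mulVf.
  rewrite (linear_onZ lD lT') // !hnormZ // x1 mulr1 exprMn [m' ^+ 2 * _]mulrC -mulrBr.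
  rewrite ComplexField.Normc.normcV exprVn ltr_pdivrMl ?exprn_gt0 //.
  apply: (@lt_le_trans _ _ (e * a ^+ 2)); last first.
    by rewrite mulrC ler_pM2r // ler_pXn2r ?nnegrE ?normc_ge0 ?(ltW a0).
  apply: lt_le_trans de.
  have := hnorm_ge0 ip2 (T' x); nra.
(* [Q z = 0] says [||T' z|| = m' ||z||], so the normalized [z] attains [m']. *)
have [Dy y1] := normalize hip1 lD Dz z0.
eexists; split; [exact: Dy | exact: y1 |].
rewrite (linear_onZ lD lT') // hnormZ // normc_real ?invr_ge0 ?hnorm_ge0 //.
have nz : hnorm ip1 z != 0 by apply: contra_neq z0; exact: hnorm_eq0.
have -> : hnorm ip2 (T' z) = m' * hnorm ip1 z.
  apply/eqP; rewrite -(@eqrXn2 _ 2) ?mulr_ge0 ?hnorm_ge0 // exprMn.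
  by rewrite -subr_eq0 Qz.
by rewrite mulrCA mulVf // mulr1.
Qed.

End Perturbation.

(** * Unit vectors in a dense domain, and the approximation theorem *)

Lemma dense_unit_vector (R : realType) (V : lmodType R[i]) (ip : V -> V -> R[i])
  (D : set V) : hilbert ip -> lin_subspace D -> dense_in ip D ->
  exists x, D x /\ hnorm ip x = 1.
Proof.
move=> [hip _ infV] lD dD; have [v vP] := infV 1%N.
have v0 : v ord0 != 0.
  apply/eqP => v0; have := vP (fun=> 1); rewrite big_ord1 scale1r.
  by move=> /(_ v0 ord0) /eqP; rewrite oner_eq0.
have nv : 0 < hnorm ip (v ord0).
  by rewrite lt_def hnorm_ge0 andbT; apply: contra_neq v0; exact: hnorm_eq0.
(* A point closer to [v] than [||v||] cannot be 0. *)
have [y [Dy vy]] := dD (v ord0) _ nv.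
have y0 : y != 0 by apply: contraTneq vy => ->; rewrite subr0 ltxx.
by eexists; exact: (normalize hip lD Dy y0).
Qed.

Unset Implicit Arguments.

Theorem theorem3p8 (R : realType) (H1 H2 : lmodType R[i])
  (ip1 : H1 -> H1 -> R[i]) (ip2 : H2 -> H2 -> R[i]) :
  hilbert ip1 -> hilbert ip2 ->
  forall (D : set H1) (T : H1 -> H2),
    densely_defined_closed ip1 ip2 D T ->
    bounded_below ip1 ip2 D T ->
    forall eps : R, 0 < eps ->
    exists (D' : set H1) (T' : H1 -> H2),
      [/\ densely_defined_closed ip1 ip2 D' T',
          min_attaining ip1 ip2 D' T'
        & gap ip1 ip2 D T D' T' <= eps].
Proof.
move=> h1 h2 D T ddcT [c [c0 cT]] eps eps0.
have [lD dD lT clT] := ddcT.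
have [hip1 c1 _] := h1; have [hip2 c2 _] := h2.
have unitD := dense_unit_vector h1 lD dD.
(* Boundedness below enters here; positivity of [m] leaves room for the strict drop of the minimum
   modulus. *)
have m0 : 0 < min_modulus ip1 ip2 D T.
  by apply: lt_le_trans c0 _; exact: min_modulus_ge.
move mE : (min_modulus ip1 ip2 D T) m0 => m m0.
(* Since [||w|| = eta ||T x0|| <= eta (1 + eta) m <= 2 m eta], the third condition gives
   [2 ||w|| <= eps^2], as [gap_le] requires. *)
have [eta [eta0 eta1 etaE]] :
    exists eta : R, [/\ 0 < eta, eta <= 2^-1 & 4 * m * eta <= eps ^+ 2].
  exists (Num.min 2^-1 (eps ^+ 2 / (4 * m))).
  have m4 : 0 < 4 * m by lra.
  split; first by rewrite lt_min invr_gt0 ltr0n divr_gt0 ?exprn_gt0.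
    by rewrite ge_min lexx.
  by rewrite mulrC -ler_pdivlMr // ge_min lexx orbT.
have [x0 [Dx0 x01 Tx0]] : exists x, [/\ D x, hnorm ip1 x = 1 &
    hnorm ip2 (T x) < m + m * eta].
  by rewrite -mE; apply: min_modulus_approx => //; rewrite mE mulr_gt0.
pose w := - (eta%:C%C *: T x0).
have nw : hnorm ip2 w = eta * hnorm ip2 (T x0).
  by rewrite hnormN // hnormZ // normc_real ?ltW.
have n0 := hnorm_ge0 ip2 (T x0).
have [lD' dD' lT' cT'] := rank_one_perturb_closed hip1 hip2 ddcT x0 w.
exists D, (rank_one_perturb ip1 T x0 w); split=> //.
- apply: rank_one_min_attaining => //; rewrite mE.
  (* Testing at [x0], where [T' x0 = (1 - eta) T x0]: the norm is below
     [(1 - eta) (1 + eta) m < m]. *)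
  have := min_modulus_le hip1 hip2 lD lT' Dx0; rewrite x01 mulr1.
  move=> /le_lt_trans; apply; rewrite /rank_one_perturb ip_self // x01 expr1n.
  have -> : T x0 + 1%:C%C *: w = (1 - eta)%:C%C *: T x0.
    by rewrite rmorphB scalerBl !scale1r.
  rewrite hnormZ // normc_real; nra.
- apply: (@gap_le _ _ _ _ _ hip1 hip2 c1 c2 _ _ _ (hnorm ip2 w)) => //.
  + exact: hnorm_ge0.
  + exact: ltW.
  + by rewrite nw; nra.
  + move=> x Dx; rewrite /rank_one_perturb opprD addNKr hnormN //.
    by have := hnorm_rank_one hip1 hip2 x0 w x; rewrite x01 mul1r.
Qed.
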